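(* Let $\mathcal{H}$ be a real Hilbert space, let $u_1,u_2\in\mathcal{H}$, let $\eta_1,\eta_2\in\mathbb{R}$, and set $W_i:=\{x\in\mathcal{H}:\langle x,u_i\rangle\le\eta_i\}$ and $H_i:=\{x\in\mathcal{H}:\langle x,u_i\rangle=\eta_i\}$ for $i\in\{1,2\}$. Then the following hold. (i) Suppose that $u_1,u_2$ are linearly dependent and that $W_1\cap W_2\neq\varnothing$. Then $P_{W_2}P_{W_1}=P_{W_1\cap W_2}$. (ii) Suppose that $u_1,u_2$ are linearly independent. (a) If $\langle u_1,u_2\rangle=0$, then $P_{W_2}P_{W_1}=P_{W_1\cap W_2}$. (b) If $\langle u_1,u_2\rangle<0$, then $\gamma:=\frac{|\langle u_1,u_2\rangle|}{\|u_1\|\|u_2\|}\in[0,1)$, and for every $x\in\mathcal{H}$ and every $k\in\mathbb{N}$, $$\|(P_{W_2}P_{W_1})^kx-P_{W_1\cap W_2}x\|\le\gamma^k\|x-P_{W_1\cap W_2}x\|.$$ (c) If $\langle u_1,u_2\rangle>0$, then $P_{W_2}P_{W_1}x\in W_1\cap W_2$ for every $x\in\mathcal{H}$. In particular: if $x\in W_1\cup W_2$, then $P_{W_2}P_{W_1}x=P_{W_1\cap W_2}x$; if $x\in W_1^c\cap W_2^c$ and $P_{H_1}x\in W_2$, then $P_{W_2}P_{W_1}x=P_{H_1}x=P_{W_1\cap W_2}x$; if $x\in W_1^c\cap W_2^c$ and $P_{H_1}x\notin W_2$, then $P_{W_2}P_{W_1}x\in (W_1\cap W_2)\smallsetminus\{P_{W_1\cap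 W_2}x\}$.
   Context: $\mathbb{N}=\{0,1,2,\ldots\}$. For a nonempty closed convex set $C\subseteq\mathcal{H}$, $P_C:\mathcal{H}\to\mathcal{H}$ maps each point to its unique nearest point in $C$; juxtaposition of projectors denotes composition. $D^c:=\mathcal{H}\smallsetminus D$. When $u_1,u_2$ are linearly independent, $W_1\cap W_2$ is nonempty. *)

(* Defs.v *)
From mathcomp Require Export all_boot all_order all_algebra sesquilinear.
From mathcomp Require Export all_classical all_reals all_analysis.

Set Implicit Arguments.
Unset Strict Implicit.
Unset Printing Implicit Defensive.

Export numFieldNormedType.Exports.
Import Order.TTheory GRing.Theory Num.Theory.

Global Open Scope classical_set_scope.
Global Open Scope ring_scope.

(* A real Hilbert space is a complete normed module [H] whose norm is induced
   by a positive definite symmetric bilinear form [ip]. The second argument of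
   [{dot H for theta}] is the conjugation, hence [idfun] over the reals. *)
Definition inner_product_norm (R : realType) (H : completeNormedModType R)
    (ip : {dot H for (@idfun R)}) : Prop :=
  forall x : H, `|x| = Num.sqrt (ip x x).

(* The library's [free] is restricted to finite-dimensional spaces. *)
Definition lin_indep (R : realType) (H : lmodType R) (u v : H) : Prop :=
  forall a b : R, a *: u + b *: v = 0 -> a = 0 /\ b = 0.

Definition lin_dep (R : realType) (H : lmodType R) (u v : H) : Prop :=
  ~ lin_indep u v.

Definition nearest (R : realType) (H : completeNormedModType R)
    (C : set H) (x : H) : set H :=
  [set p | C p /\ forall y, C y -> `|x - p| <= `|x - y|].

(* In a Hilbert space, [nearest C x] is a singleton when [C] is nonempty, closed
   and convex. The default value [x] only matters if [nearest C x] is empty. *)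
Definition proj (R : realType) (H : completeNormedModType R)
    (C : set H) (x : H) : H :=
  xget x (nearest C x).

Definition halfspace (R : realType) (H : completeNormedModType R)
    (ip : {dot H for (@idfun R)}) (u : H) (eta : R) : set H :=
  [set x | ip x u <= eta].

Definition hyperplane (R : realType) (H : completeNormedModType R)
    (ip : {dot H for (@idfun R)}) (u : H) (eta : R) : set H :=
  [set x | ip x u = eta].

(* Main.v *)
Require Import Defs.
From mathcomp Require Import ring lra.
Set Implicit Arguments.
Unset Strict Implicit.
Unset Printing Implicit Defensive.
Import Order.TTheory GRing.Theory Num.Theory.

(** Everything is read off from multipliers. If [x - p] is a combination
    [a *: u1 + b *: u2] of the outer normals with nonnegative coefficients, if
    [p] lies in both half-spaces, and if each coefficient vanishes unless [p] is
    on the corresponding boundary, then [x - p] makes an obtuse angle with every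
    direction from [p] into the intersection, so [p] is the projection of [x]
    ([proj_kkt]). One half-space gives the explicit formula
    [x - (max (<x,u> - eta) 0 / |u|^2) u], so the composition of two projections
    subtracts nonnegative multiples of [u1] and [u2], and it equals the
    projection onto the intersection as soon as the two other requirements hold.

    When the normals are dependent or orthogonal, this is checked directly
    ([proj_comp_dep], [proj_comp_orthogonal]); dependent normals with a negative
    ratio bound a slab, and with a positive ratio one half-space contains the
    other.

    When [<u1,u2> <= 0], projecting [x] onto one half-space can only lower the
    coefficient of its normal, and not below zero: the point [p] stays admissible, hence stays the
    projection onto the intersection ([kkt_proj_halfspace]). So all iterates
    share the same [p], and it suffices that one sweep contracts the distance
    to [p] by the cosine of the angle between the normals
    ([alternating_contraction]). This is an inequality between two values of the
    quadratic form of the Gram matrix ([quadratic_contraction]). It uses that the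
    end point of a sweep has the smallest possible distance to [p] among the
    points with the same coefficient of [u1].

    When [<u1,u2> > 0], the second projection moves in the direction [- u2],
    which decreases [<.,u1>], so the result stays in the first half-space. If
    both projections really move, the result is strictly inside the first
    half-space although the coefficient of [u1] is positive. The coefficients
    are unique by linear independence, so the result violates the optimality
    conditions that the true projection satisfies ([proj_comp_acute_neq]); this
    is where the existence of multipliers, [kkt_exists], is needed. *)

(** * Two scalar facts about a two by two Gram matrix *)

(** Finding the multipliers for two half-spaces is a linear complementarity
    problem for the Gram matrix with diagonal [A], [B] and off-diagonal entry
    [g]. Positive definiteness makes one of four candidates work: no constraint
    active, one of them active, or both (Cramer's rule). *)
Lemma gram_complementarity (R : realFieldType) (A B g r1 r2 : R) :
  0 < A -> 0 < B -> g ^+ 2 < A * B ->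
  exists a b, let s1 := r1 - (a * A + b * g) in
    let s2 := r2 - (a * g + b * B) in
    [/\ 0 <= a, 0 <= b, s1 <= 0 /\ s2 <= 0 & (a = 0 \/ s1 = 0) /\ (b = 0 \/ s2 = 0)].
Proof.
move=> A0 B0 D0 /=.
have [/andP[r1_0 r2_0]|nin] := boolP ((r1 <= 0) && (r2 <= 0)).
  by exists 0, 0; split => //; [split|split; left]; lra.
have [/andP[r1_0 n1]|n1] := boolP ((0 < r1) && (A * r2 <= g * r1)).
  have a0 : 0 <= r1 / A by rewrite divr_ge0// ltW.
  have aA : r1 / A * A = r1 by rewrite divfK// gt_eqF.
  exists (r1 / A), 0; split=> //; last by split; [right; lra|left].
  split; first by lra.
  rewrite -(pmulr_rle0 _ A0).
  have : A * (r1 / A * g) = r1 * g by rewrite -{2}aA; ring.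
  lra.
have [/andP[r2_0 n2]|n2] := boolP ((0 < r2) && (B * r1 <= g * r2)).
  have b0 : 0 <= r2 / B by rewrite divr_ge0// ltW.
  have bB : r2 / B * B = r2 by rewrite divfK// gt_eqF.
  exists 0, (r2 / B); split=> //; last by split; [left|right; lra].
  split; last by lra.
  rewrite -(pmulr_rle0 _ B0).
  have : B * (r2 / B * g) = r2 * g by rewrite -{2}bB; ring.
  lra.
have {}D0 : 0 < A * B - g ^+ 2 by rewrite subr_gt0.
have e1 : r1 - ((B * r1 - g * r2) / (A * B - g ^+ 2) * A +
    (A * r2 - g * r1) / (A * B - g ^+ 2) * g) = 0 by field; rewrite gt_eqF.
have e2 : r2 - ((B * r1 - g * r2) / (A * B - g ^+ 2) * g +
    (A * r2 - g * r1) / (A * B - g ^+ 2) * B) = 0 by field; rewrite gt_eqF.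
(* The numerators in Cramer's rule are nonnegative once no single constraint
   suffices; when exactly one residual is positive this forces [g < 0]. *)
have cramer_ge0 (A' B' s1 s2 : R) : 0 < B' -> 0 < A' * B' - g ^+ 2 ->
    s1 <= 0 -> 0 < s2 -> g * s2 < B' * s1 -> g * s1 <= A' * s2.
  move=> B'0 D'0 s1_0 s2_0 lt_s.
  have g0 : g < 0.
    by rewrite -(pmulr_llt0 _ s2_0) (lt_le_trans lt_s)// mulr_ge0_le0// ltW.
  rewrite -(ler_pM2l B'0) -subr_ge0.
  have -> : B' * (A' * s2) - B' * (g * s1) =
      (A' * B' - g ^+ 2) * s2 + (- g) * (B' * s1 - g * s2) by ring.
  by apply: addr_ge0; apply: mulr_ge0; rewrite ltW// ?oppr_gt0 ?subr_gt0.
have [num1 num2] : 0 <= B * r1 - g * r2 /\ 0 <= A * r2 - g * r1.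
  move: nin n1 n2; rewrite !negb_and -!leNgt -!ltNge.
  have [r1_0|r1_0] /= := leP r1 0; have [r2_0|r2_0] //= := leP r2 0 => _ n1 n2.
  - by have := cramer_ge0 A B r1 r2 B0 D0 r1_0 r2_0 n2; split; lra.
  - have D0' : 0 < B * A - g ^+ 2 by rewrite mulrC.
    by have := cramer_ge0 B A r2 r1 A0 D0' r2_0 r1_0 n1; split; lra.
  - by split; lra.
exists ((B * r1 - g * r2) / (A * B - g ^+ 2)), ((A * r2 - g * r1) / (A * B - g ^+ 2)).
rewrite e1 e2; split; [| |by []|by split; right].
- by apply: divr_ge0 => //; apply: ltW.
- by apply: divr_ge0 => //; apply: ltW.
Qed.

(** With [D = A B - g^2], the value of the form at [(a', b')] is
    [a'^2 D / B], since [b'] minimises it for this [a'], while its value at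
    [(a, b)] is at least the minimum [b^2 D / A] over the first coefficient.
    The bound [a' A <= - b g] compares the two. Denominators are cleared. *)
Lemma quadratic_contraction (R : realFieldType) (A B g a b a' b' : R) :
  0 < A -> 0 < B -> g ^+ 2 <= A * B ->
  0 <= a' -> a' * A <= - (b * g) -> b' * B = - (a' * g) ->
  A * B * (a' ^+ 2 * A + 2 * a' * b' * g + b' ^+ 2 * B) <=
  g ^+ 2 * (a ^+ 2 * A + 2 * a * b * g + b ^+ 2 * B).
Proof.
move=> A0 B0 D0 a'0 a'A b'B.
rewrite -(ler_pM2l A0).
have -> : A * (A * B * (a' ^+ 2 * A + 2 * a' * b' * g + b' ^+ 2 * B)) =
    (a' * A) ^+ 2 * (A * B - g ^+ 2).
  have -> : A * (A * B * (a' ^+ 2 * A + 2 * a' * b' * g + b' ^+ 2 * B)) =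
    A ^+ 2 * (a' ^+ 2 * A * B + 2 * a' * g * (b' * B) + (b' * B) ^+ 2) by ring.
  by rewrite b'B; ring.
have -> : A * (g ^+ 2 * (a ^+ 2 * A + 2 * a * b * g + b ^+ 2 * B)) =
    g ^+ 2 * (a * A + b * g) ^+ 2 + (- (b * g)) ^+ 2 * (A * B - g ^+ 2) by ring.
apply: (@le_trans _ _ ((- (b * g)) ^+ 2 * (A * B - g ^+ 2))).
  rewrite ler_wpM2r ?subr_ge0// ler_sqr// nnegrE ?(le_trans _ a'A)//.
    by rewrite mulr_ge0// ltW.
  by rewrite mulr_ge0// ltW.
by rewrite lerDr mulr_ge0 ?sqr_ge0.
Qed.

(** * Inner products *)

Section Projections.
Context (R : realType) (H : completeNormedModType R).
Context (ip : {dot H for (@idfun R)}).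
Implicit Types (x y p u v : H) (a b eta : R) (C : set H).

Lemma ipC x y : ip x y = ip y x.
Proof. by rewrite hermC /= expr0 mul1r. Qed.

Lemma ip_gt0 x : x != 0 -> 0 < ip x x.
Proof. exact: neq0_dnorm_gt0. Qed.

Lemma ip_ge0 x : 0 <= ip x x.
Proof. by have [->|/ip_gt0/ltW//] := eqVneq x 0; rewrite linear0r. Qed.

Lemma ip_normDZ x u a :
  ip (x + a *: u) (x + a *: u) = ip x x + 2 * a * ip x u + a ^+ 2 * ip u u.
Proof.
rewrite linearDl !linearDr /= linearZl_LR /= !linearZr_LR /= (ipC u x).
rewrite linearZl_LR /=; ring.
Qed.

Lemma ip_combl a b u v x : ip (a *: u + b *: v) x = a * ip u x + b * ip v x.
Proof. by rewrite linearDl !linearZl_LR. Qed.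

Lemma ip_comb_sqr a b u v : ip (a *: u + b *: v) (a *: u + b *: v) =
  a ^+ 2 * ip u u + 2 * a * b * ip u v + b ^+ 2 * ip v v.
Proof. by rewrite ip_combl !(ipC _ (_ + _)) !ip_combl (ipC v u); ring. Qed.

Lemma lin_indepC u v : lin_indep u v -> lin_indep v u.
Proof. by move=> uv a b; rewrite addrC => /uv[]. Qed.

Lemma lin_indep_neq0 u v : lin_indep u v -> u != 0.
Proof.
move=> uv; apply/eqP => u0; have [|/eqP] := uv 1 0; last by rewrite oner_eq0.
by rewrite u0 scaler0 scale0r addr0.
Qed.

(** Strict Cauchy-Schwarz: expand the square of the nonzero vector
    [<v,v> u - <u,v> v]. *)
Lemma ip_sqr_lt u v : lin_indep u v -> ip u v ^+ 2 < ip u u * ip v v.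
Proof.
move=> uv.
have vv := ip_gt0 (lin_indep_neq0 (lin_indepC uv)).
have w0 : ip v v *: u + (- ip u v) *: v != 0.
  by apply/eqP => /uv[/eqP]; rewrite gt_eqF.
have := ip_gt0 w0; rewrite ip_comb_sqr.
have -> : ip v v ^+ 2 * ip u u + 2 * ip v v * - ip u v * ip u v +
    (- ip u v) ^+ 2 * ip v v = ip v v * (ip u u * ip v v - ip u v ^+ 2) by ring.
by rewrite pmulr_rgt0// subr_gt0.
Qed.

(** * Projections and multipliers *)

Context (ip_norm : inner_product_norm ip).

Lemma norm_sqr x : `|x| ^+ 2 = ip x x.
Proof. by rewrite ip_norm sqr_sqrtr// ip_ge0. Qed.

(** The obtuse angle condition gives
    [|x - p|^2 + |y - p|^2 <= |x - y|^2] on [C], hence both that [p] is nearest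
    and that no other point is. *)
Lemma proj_obtuse C x p : C p ->
  (forall y, C y -> ip (x - p) (y - p) <= 0) -> proj C x = p.
Proof.
move=> Cp obt.
have pyth y : C y -> ip (x - p) (x - p) + ip (y - p) (y - p) <= ip (x - y) (x - y).
  move=> /obt le0.
  have -> : x - y = (x - p) + (-1) *: (y - p).
    by rewrite scaleN1r opprB addrA subrK.
  by rewrite ip_normDZ; lra.
apply: xget_subset1 => [|q r [Cq minq] [Cr minr]].
  split=> // y Cy; rewrite -ler_sqr ?nnegrE// !norm_sqr.
  by have := pyth y Cy; have := ip_ge0 (y - p); lra.
have eqp z : nearest C x z -> z = p.
  move=> [Cz minz]; apply/eqP; rewrite -subr_eq0; apply/negPn/negP => /ip_gt0.
  have := pyth z Cz; have := minz p Cp.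
  by rewrite -ler_sqr ?nnegrE// !norm_sqr; lra.
by rewrite (eqp q)// (eqp r).
Qed.

(** The Karush-Kuhn-Tucker conditions for minimising the distance from [x] to
    the intersection of two half-spaces, with minimiser [p] and multipliers
    [a] and [b]. *)
Definition kkt u1 eta1 u2 eta2 x p a b : Prop :=
  [/\ x = p + (a *: u1 + b *: u2), 0 <= a /\ 0 <= b,
      ip p u1 <= eta1 /\ ip p u2 <= eta2,
      a = 0 \/ ip p u1 = eta1 & b = 0 \/ ip p u2 = eta2].

Lemma kktC u1 eta1 u2 eta2 x p a b :
  kkt u1 eta1 u2 eta2 x p a b -> kkt u2 eta2 u1 eta1 x p b a.
Proof. by case=> -> [? ?] [? ?] ? ?; split => //; rewrite (addrC (b *: _)). Qed.

Lemma proj_kkt u1 eta1 u2 eta2 x p a b : kkt u1 eta1 u2 eta2 x p a b ->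
  proj (halfspace ip u1 eta1 `&` halfspace ip u2 eta2) x = p.
Proof.
case=> -> [a0 b0] [p1 p2] sa sb; apply: proj_obtuse => // y [/= y1 y2].
rewrite addrC addKr ip_combl !(ipC _ (y - p)) !linearBl /=.
have : a * (ip y u1 - ip p u1) <= 0.
  by case: sa => [->|->]; [rewrite mul0r|rewrite mulr_ge0_le0// subr_le0].
have : b * (ip y u2 - ip p u2) <= 0.
  by case: sb => [->|->]; [rewrite mul0r|rewrite mulr_ge0_le0// subr_le0].
lra.
Qed.

Lemma proj_id C x : C x -> proj C x = x.
Proof. by move=> Cx; apply: proj_obtuse => // y _; rewrite subrr linear0l. Qed.

Lemma proj_halfspace_out u eta x : u != 0 -> eta <= ip x u ->
  proj (halfspace ip u eta) x = x - ((ip x u - eta) / ip u u) *: u.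
Proof.
move=> /ip_gt0 uu xu; set a := _ / _.
have aE : a * ip u u = ip x u - eta by rewrite /a divfK// gt_eqF.
have a0 : 0 <= a by rewrite divr_ge0 ?subr_ge0// ltW.
have pu : ip (x - a *: u) u = eta by rewrite linearBl /= linearZl_LR /= aE; lra.
rewrite -[halfspace _ _ _]setIid; apply: (@proj_kkt _ _ _ _ _ _ a 0).
split; rewrite ?pu//; last by right.
- by rewrite scale0r addr0 subrK.
- by right.
Qed.

Lemma proj_hyperplane u eta x : u != 0 ->
  proj (hyperplane ip u eta) x = x - ((ip x u - eta) / ip u u) *: u.
Proof.
move=> /ip_gt0 uu; set a := _ / _.
have aE : a * ip u u = ip x u - eta by rewrite /a divfK// gt_eqF.
have pu : ip (x - a *: u) u = eta by rewrite linearBl /= linearZl_LR /= aE; lra.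
apply: proj_obtuse => // y /= yu.
rewrite subKr linearZl_LR /= ipC linearBl /=.
by rewrite pu yu subrr mulr0.
Qed.

(** The quantity [a] is the multiplier of the projection. It is only described
    by equations, so that no quotient enters later computations. *)
Lemma proj_halfspaceP u eta x : u != 0 -> exists2 a,
  proj (halfspace ip u eta) x = x - a *: u &
  (ip x u <= eta /\ a = 0) \/ [/\ eta < ip x u, 0 < a & a * ip u u = ip x u - eta].
Proof.
move=> u0; have [xu|xu] := leP (ip x u) eta.
  by exists 0; [rewrite scale0r subr0 proj_id|left].
have uu := ip_gt0 u0.
exists ((ip x u - eta) / ip u u); first by rewrite proj_halfspace_out// ltW.
by right; split=> //; rewrite ?divr_gt0 ?subr_gt0// divfK// gt_eqF.
Qed.

Lemma ipBZl x u v a : ip (x - a *: u) v = ip x v - a * ip u v.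
Proof. by rewrite linearBl /= linearZl_LR. Qed.

Lemma kkt_exists u1 eta1 u2 eta2 x : lin_indep u1 u2 ->
  exists p a b, kkt u1 eta1 u2 eta2 x p a b.
Proof.
move=> uv; have := ip_sqr_lt uv.
have := ip_gt0 (lin_indep_neq0 uv).
have := ip_gt0 (lin_indep_neq0 (lin_indepC uv)).
set A := ip u1 u1; set B := ip u2 u2; set g := ip u1 u2 => B0 A0 D0.
have [a [b /= [a0 b0 [s1 s2] [c1 c2]]]] :=
  gram_complementarity (ip x u1 - eta1) (ip x u2 - eta2) A0 B0 D0.
exists (x - (a *: u1 + b *: u2)), a, b.
have e1 : ip (x - (a *: u1 + b *: u2)) u1 = ip x u1 - (a * A + b * g).
  by rewrite linearBl /= ip_combl (ipC u2 u1).
have e2 : ip (x - (a *: u1 + b *: u2)) u2 = ip x u2 - (a * g + b * B).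
  by rewrite linearBl /= ip_combl.
by split; rewrite ?subrK ?e1 ?e2 //;
  [split; lra|case: c1; [left|right]; lra|case: c2; [left|right]; lra].
Qed.

(** * Obtuse normals *)

(** If the point moves, then [a] is positive, [p] is on the first boundary, and
    [a] drops to the value [a'] for which the new point is on that boundary,
    that is [a' <u1,u1> + b <u1,u2> = 0]. Since [<u1,u2> <= 0] this value is
    nonnegative, so [p] remains optimal. If the point stays put, then either
    [a = 0] or membership of the half-space gives the inequality. *)
Lemma kkt_proj_halfspace u1 eta1 u2 eta2 x p a b :
  u1 != 0 -> ip u1 u2 <= 0 -> kkt u1 eta1 u2 eta2 x p a b ->
  exists a', [/\ kkt u1 eta1 u2 eta2 (proj (halfspace ip u1 eta1) x) p a' b,
    a' * ip u1 u1 <= - (b * ip u1 u2) &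
    a' = a \/ a' * ip u1 u1 = - (b * ip u1 u2)].
Proof.
move=> u0 g0 [xE [a0 b0] [p1 p2] sa sb].
have bg : 0 <= - (b * ip u1 u2) by rewrite -mulrN mulr_ge0// oppr_ge0.
have xu : ip x u1 = ip p u1 + a * ip u1 u1 + b * ip u1 u2.
  by rewrite xE linearDl /= ip_combl (ipC u2 u1) addrA.
have uu := ip_gt0 u0.
have [d -> [[xW d0]|[xW d0 dE]]] := proj_halfspaceP eta1 x u0.
  exists a; rewrite d0 scale0r subr0; split; [by []| |by left].
  by case: sa => [->|]; [rewrite mul0r|lra].
have peta : ip p u1 = eta1 by case: sa => // aE; move: xu; rewrite aE mul0r; lra.
have adE : (a - d) * ip u1 u1 = - (b * ip u1 u2) by rewrite mulrBl; lra.
have ad0 : 0 <= a - d by rewrite -(pmulr_lge0 _ uu) adE.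
exists (a - d); split; [|by rewrite adE|by right].
split=> //; last by right.
by rewrite {1}xE scalerBl -!addrA; congr (p + (_ + _)); rewrite addrC.
Qed.

Definition normal_cos u1 u2 : R := `|ip u1 u2| / (`|u1| * `|u2|).

Lemma normal_cos_bounds u1 u2 : lin_indep u1 u2 -> 0 <= normal_cos u1 u2 < 1.
Proof.
move=> uv; rewrite /normal_cos divr_ge0 ?mulr_ge0//=.
have n1 : 0 < `|u1| by rewrite normr_gt0 (lin_indep_neq0 uv).
have n2 : 0 < `|u2| by rewrite normr_gt0 (lin_indep_neq0 (lin_indepC uv)).
rewrite ltr_pdivrMr ?mulr_gt0// mul1r -ltr_sqr ?nnegrE ?mulr_ge0//.
by rewrite exprMn !norm_sqr real_normK ?num_real ?ip_sqr_lt.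
Qed.

(** Multipliers for the new point and the same [p] are returned together with
    the estimate, so that the step can be iterated. *)
Lemma alternating_contraction u1 eta1 u2 eta2 x p a b :
  lin_indep u1 u2 -> ip u1 u2 <= 0 -> kkt u1 eta1 u2 eta2 x p a b ->
  exists a' b', let x' := proj (halfspace ip u2 eta2)
                              (proj (halfspace ip u1 eta1) x) in
    kkt u1 eta1 u2 eta2 x' p a' b' /\
    `|x' - p| <= normal_cos u1 u2 * `|x - p|.
Proof.
move=> uv g0 kx.
have u10 := lin_indep_neq0 uv; have u20 := lin_indep_neq0 (lin_indepC uv).
have D := ip_sqr_lt uv.
have [a' [k1 a'A _]] := kkt_proj_halfspace u10 g0 kx.
have g0' : ip u2 u1 <= 0 by rewrite ipC.
have a'0 : 0 <= a' by case: k1 => _ [].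
have [b' [/kktC k2 b'B b'E]] := kkt_proj_halfspace u20 g0' (kktC k1).
set x' := proj _ _ in k2 *.
exists a', b'; split => //.
rewrite (ipC u2 u1) in b'B b'E.
(* The second projection always ends at the critical value: keeping [b]
   unchanged and subcritical would contradict strict Cauchy-Schwarz unless
   [b = 0], and then [a'] vanishes as well. *)
have {}b'E : b' * ip u2 u2 = - (a' * ip u1 u2).
  case: b'E => // bb'; rewrite {}bb' in b'B *.
  have [b0|b0] := leP b 0.
    have bE : b = 0 by apply/eqP; rewrite eq_le b0; case: kx => _ [].
    have : a' * ip u1 u1 <= 0 by move: a'A; rewrite bE mul0r oppr0.
    rewrite pmulr_lle0 ?ip_gt0// => a'_0.
    have -> : a' = 0 by apply/eqP; rewrite eq_le a'_0.
    by rewrite bE !mul0r oppr0.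
  have : b * (ip u1 u1 * ip u2 u2) <= b * ip u1 u2 ^+ 2.
    have A0 := ip_gt0 u10; rewrite mulrCA; nra.
  by rewrite ler_pM2l// leNgt D.
have := @quadratic_contraction _ _ _ _ a b _ _ (ip_gt0 u10) (ip_gt0 u20) (ltW D) a'0 a'A b'E.
have normE y c d : kkt u1 eta1 u2 eta2 y p c d ->
    `|y - p| ^+ 2 = c ^+ 2 * ip u1 u1 + 2 * c * d * ip u1 u2 + d ^+ 2 * ip u2 u2.
  by case=> yE _ _ _ _; rewrite {1}yE addrAC subrr add0r norm_sqr ip_comb_sqr.
rewrite -(normE _ _ _ k2) -(normE _ _ _ kx) -!norm_sqr.
rewrite -(real_normK (num_real (ip u1 u2))) -!exprMn => le_sq.
have n12 : 0 < `|u1| * `|u2| by rewrite mulr_gt0// normr_gt0.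
rewrite /normal_cos mulrAC ler_pdivlMr// mulrC.
by rewrite -ler_sqr ?nnegrE ?mulr_ge0.
Qed.

Lemma iter_alternating_contraction u1 eta1 u2 eta2 x k :
  lin_indep u1 u2 -> ip u1 u2 <= 0 ->
  let W1 := halfspace ip u1 eta1 in let W2 := halfspace ip u2 eta2 in
  (`|iter k (proj W2 \o proj W1) x - proj (W1 `&` W2) x| <=
  normal_cos u1 u2 ^+ k * `|x - proj (W1 `&` W2) x| : Prop).
Proof.
move=> uv g0 W1 W2.
have [p [a [b kx]]] := kkt_exists eta1 eta2 x uv.
rewrite (proj_kkt kx).
have /andP[c0 _] := normal_cos_bounds uv.
elim: k x a b kx => [|k IH] x a b kx; first by rewrite expr0 mul1r.
have [a' [b' [/IH {}IH le1]]] := alternating_contraction uv g0 kx.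
rewrite iterSr (le_trans IH)// exprSr -mulrA ler_wpM2l ?exprn_ge0//.
Qed.

(** * Dependent and orthogonal normals *)

Lemma lin_dep_collinear u1 u2 : lin_dep u1 u2 -> u1 != 0 ->
  exists c, u2 = c *: u1.
Proof.
move=> dep u10; apply: contrapT => ncol; apply: dep => a b ab0.
have [b0|b0] := eqVneq b 0.
  split=> //; apply/eqP; have /eqP := ab0.
  by rewrite b0 scale0r addr0 scaler_eq0 (negPf u10) orbF.
exfalso; apply: ncol; exists (- (b^-1 * a)).
by rewrite scaleNr -scalerA -[u2](scalerK b0) -scalerN; congr (_ *: _);
  apply/eqP; rewrite -addr_eq0 addrC ab0.
Qed.

(** The form of [proj_kkt] that matches the output of successive projections. *)
Lemma proj_sub_normals u1 eta1 u2 eta2 x a b : 0 <= a -> 0 <= b ->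
  ip (x - (a *: u1 + b *: u2)) u1 <= eta1 ->
  ip (x - (a *: u1 + b *: u2)) u2 <= eta2 ->
  a = 0 \/ ip (x - (a *: u1 + b *: u2)) u1 = eta1 ->
  b = 0 \/ ip (x - (a *: u1 + b *: u2)) u2 = eta2 ->
  proj (halfspace ip u1 eta1 `&` halfspace ip u2 eta2) x =
    x - (a *: u1 + b *: u2).
Proof. by move=> *; apply: (@proj_kkt _ _ _ _ _ _ a b); split; rewrite ?subrK. Qed.

(** The minimum over the larger set [W] is attained in [W `&` D]. *)
Lemma proj_halfspaceI u eta D x : u != 0 ->
  D (proj (halfspace ip u eta) x) ->
  proj (halfspace ip u eta `&` D) x = proj (halfspace ip u eta) x.
Proof.
move=> u0; have [a -> aP] := proj_halfspaceP eta x u0 => Dp.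
have [a0 [pW slack]] : 0 <= a /\ ip (x - a *: u) u <= eta /\
    (a = 0 \/ ip (x - a *: u) u = eta).
  rewrite ipBZl; case: aP => [[xW ->]|[xW a0 aE]].
    by rewrite mul0r subr0; split=> //; split=> //; left.
  by rewrite aE; split; [exact: ltW|split; [lra|right; lra]].
apply: proj_obtuse => // y [/= yW _].
rewrite subKr linearZl_LR /= ipC linearBl /=.
case: slack => ->; first by rewrite mul0r.
by rewrite mulr_ge0_le0// subr_le0.
Qed.

Lemma proj_halfspace_mem u eta x : u != 0 ->
  halfspace ip u eta (proj (halfspace ip u eta) x).
Proof.
move=> u0; have [a -> [[xW ->]|[_ _ aE]]] := proj_halfspaceP eta x u0;
  rewrite /halfspace /= ipBZl; lra.
Qed.

Lemma halfspace0 eta : halfspace ip 0 eta !=set0 -> halfspace ip 0 eta = setT.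
Proof.
move=> [z]; rewrite /halfspace /= linear0r => eta0.
by apply/seteqP; split=> // y _ /=; rewrite linear0r.
Qed.

(** In both situations only one of the two projections moves the point, and it
    lands in the intersection. *)
Lemma proj_comp_sufficient u1 eta1 u2 eta2 x : u1 != 0 -> u2 != 0 ->
  let W1 := halfspace ip u1 eta1 in let W2 := halfspace ip u2 eta2 in
  W2 (proj W1 x) \/ W1 x /\ W1 (proj W2 x) ->
  proj W2 (proj W1 x) = proj (W1 `&` W2) x.
Proof.
move=> u10 u20 /= [pW|[xW pW]]; first by rewrite proj_halfspaceI// proj_id.
by rewrite setIC proj_halfspaceI// (proj_id xW).
Qed.

Lemma proj_comp_dep u1 eta1 u2 eta2 x : lin_dep u1 u2 ->
  halfspace ip u1 eta1 `&` halfspace ip u2 eta2 !=set0 ->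
  proj (halfspace ip u2 eta2) (proj (halfspace ip u1 eta1) x) =
  proj (halfspace ip u1 eta1 `&` halfspace ip u2 eta2) x.
Proof.
move=> dep [z [z1 z2]].
have [u10|u10] := eqVneq u1 0.
  by rewrite u10 in z1 *; rewrite halfspace0 ?setTI ?(@proj_id setT)//; exists z.
have [c u2E] := lin_dep_collinear dep u10.
have [u20|u20] := eqVneq u2 0.
  by rewrite u20 in z2 *; rewrite halfspace0 ?setIT ?(@proj_id setT)//; exists z.
have A0 := ip_gt0 u10.
have ip2 y : ip y u2 = c * ip y u1 by rewrite u2E linearZr_LR.
have z1' : ip z u1 <= eta1 := z1.
have z2' : c * ip z u1 <= eta2 by rewrite -ip2.
have [a P1 aP] := proj_halfspaceP eta1 x u10.
have [c0|c0|c0] := ltgtP c 0; last by rewrite u2E c0 scale0r eqxx in u20.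
  (* A slab, nonempty because of [z]: projecting onto one side never leaves the
     half-space of the other, so only one of the two projections moves. *)
  have slab : c * eta1 <= eta2 by rewrite (le_trans _ z2')// ler_wnM2l// ltW.
  apply: proj_comp_sufficient => //.
  case: aP => [[xW _]|[xW a0 aE]]; last first.
    left; rewrite P1 /halfspace /= ipBZl ip2.
    rewrite (ip2 u1) mulrCA aE; lra.
  right; split=> //.
  have [b -> [[_ ->]|[_ b0 bE]]] := proj_halfspaceP eta2 x u20.
    by rewrite scale0r subr0.
  have : ip (x - b *: u2) u2 = eta2 by rewrite ipBZl bE subKr.
  by rewrite /halfspace /= ip2 => bE'; rewrite -(ler_nM2l c0) bE'.
(* Parallel normals in the same direction: the half-spaces are nested. *)
case: aP => [[xW _]|[xW a0 aE]].
  apply: proj_comp_sufficient => //; right; split=> //.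
  have [b -> bP] := proj_halfspaceP eta2 x u20.
  have b0 : 0 <= b by case: bP => [[_ ->//]|[_ /ltW]].
  rewrite /halfspace /= ipBZl (ipC u2) ip2.
  have : 0 <= b * (c * ip u1 u1) by rewrite !mulr_ge0// ltW.
  lra.
have [pW|pW] := leP (ip (proj (halfspace ip u1 eta1) x) u2) eta2.
  by apply: proj_comp_sufficient => //; left.
have [b -> [[]|[_ b0 bE]]] := proj_halfspaceP eta2 (proj (halfspace ip u1 eta1) x) u20.
  by rewrite leNgt pW.
(* Both projections move, so the second half-space is the smaller one. The two
   steps are added up as one multiple of [u2], because the first constraint is
   not active at the end. *)
have E : proj (halfspace ip u1 eta1) x - b *: u2 = x - (0 *: u1 + (a / c + b) *: u2).
  rewrite P1 scale0r add0r scalerDl {2}u2E scalerA divfK ?gt_eqF//.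
  by rewrite opprD addrA.
have TE y : ip (proj (halfspace ip u1 eta1) x - b *: u2) y =
    ip (proj (halfspace ip u1 eta1) x) y - b * ip u2 y by exact: ipBZl.
symmetry; rewrite E; apply: proj_sub_normals => //; rewrite -?E ?TE ?bE.
- by rewrite addr_ge0 ?divr_ge0// ltW.
- rewrite P1 ipBZl aE (ipC u2) ip2.
  have : 0 <= b * (c * ip u1 u1) by rewrite !mulr_ge0// ltW.
  lra.
- by rewrite subKr.
- by left.
- by right; rewrite subKr.
Qed.

Lemma proj_comp_orthogonal u1 eta1 u2 eta2 x : u1 != 0 -> u2 != 0 ->
  ip u1 u2 = 0 ->
  proj (halfspace ip u2 eta2) (proj (halfspace ip u1 eta1) x) =
  proj (halfspace ip u1 eta1 `&` halfspace ip u2 eta2) x.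
Proof.
move=> u10 u20 g0.
have [a -> aP] := proj_halfspaceP eta1 x u10.
have [b -> ] := proj_halfspaceP eta2 (x - a *: u1) u20.
rewrite !ipBZl g0 mulr0 subr0 -addrA -opprD => bP; symmetry.
apply: proj_sub_normals; rewrite ?[ip (x - (_ + _)) _]linearBl /= ?ip_combl ?(ipC u2 u1) ?g0.
- by case: aP => [[_ ->]|[_ /ltW]].
- by case: bP => [[_ ->]|[_ /ltW]].
- by case: aP => [[? ->]|[_ _ ->]]; lra.
- by case: bP => [[? ->]|[_ _ ->]]; lra.
- by case: aP => [[? ->]|[_ _ ->]]; [left|right; lra].
- by case: bP => [[? ->]|[_ _ ->]]; [left|right; lra].
Qed.

(** * Acute normals *)

Lemma proj_comp_acute_mem u1 eta1 u2 eta2 x : u1 != 0 -> u2 != 0 ->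
  0 <= ip u1 u2 ->
  let W1 := halfspace ip u1 eta1 in let W2 := halfspace ip u2 eta2 in
  (W1 `&` W2) (proj W2 (proj W1 x)).
Proof.
move=> u10 u20 g0 W1 W2; split; last exact: proj_halfspace_mem.
have : W1 (proj W1 x) by exact: proj_halfspace_mem.
have [b -> bP] := proj_halfspaceP eta2 (proj W1 x) u20.
have b0 : 0 <= b by case: bP => [[_ ->//]|[_ /ltW]].
rewrite /W1 /halfspace /= ipBZl (ipC u2).
have : 0 <= b * ip u1 u2 by rewrite mulr_ge0.
lra.
Qed.

Lemma proj_comp_acute_union u1 eta1 u2 eta2 x : u1 != 0 -> u2 != 0 ->
  0 <= ip u1 u2 ->
  let W1 := halfspace ip u1 eta1 in let W2 := halfspace ip u2 eta2 in
  (W1 `|` W2) x -> proj W2 (proj W1 x) = proj (W1 `&` W2) x.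
Proof.
move=> u10 u20 g0 W1 W2 xW; apply: proj_comp_sufficient => //.
case: xW => xW; [right|left].
  have [] := proj_comp_acute_mem eta1 eta2 x u10 u20 g0.
  by rewrite (proj_id xW).
rewrite ipC in g0; have [] := proj_comp_acute_mem eta2 eta1 x u20 u10 g0.
by rewrite (proj_id xW).
Qed.

(** The composition ends at distance [b <u1,u2> > 0], measured by [<.,u1>],
    inside the first boundary, with coefficient [a > 0] on [u1]; complementary
    slackness at the projection forbids this. *)
Lemma proj_comp_acute_neq u1 eta1 u2 eta2 x : lin_indep u1 u2 ->
  0 < ip u1 u2 ->
  let W1 := halfspace ip u1 eta1 in let W2 := halfspace ip u2 eta2 in
  ~ W1 x -> ~ W2 (proj W1 x) -> proj W2 (proj W1 x) <> proj (W1 `&` W2) x.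
Proof.
move=> uv g0 W1 W2 xW1 pW2.
have [p [a' [b' kx]]] := kkt_exists eta1 eta2 x uv.
rewrite (proj_kkt kx); case: kx => xE _ _ sa _.
have [a P1 aP] := proj_halfspaceP eta1 x (lin_indep_neq0 uv).
case: aP => [[/xW1//]|[_ a0 aE]].
have [b -> bP] := proj_halfspaceP eta2 (proj W1 x) (lin_indep_neq0 (lin_indepC uv)).
case: bP => [[/pW2//]|[_ b0 _]]; rewrite P1 => pE.
have aa' : a = a'.
  have : (a - a') *: u1 + (b - b') *: u2 = 0.
    apply/eqP; rewrite !scalerBl addrACA -opprD subr_eq0; apply/eqP.
    by apply: (addrI p); rewrite -xE -pE -(addrA x) -opprD subrK.
  by move=> /uv[/subr0_eq].
have pu : ip p u1 = eta1 - b * ip u1 u2.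
  by rewrite -pE !ipBZl aE subKr (ipC u2).
case: sa => [a'0|]; first by rewrite aa' a'0 ltxx in a0.
have : 0 < b * ip u1 u2 by rewrite mulr_gt0.
rewrite pu; lra.
Qed.

End Projections.

(** * Composition of two half-space projections *)

Theorem theorem4p17 (R : realType) (H : completeNormedModType R)
    (ip : {dot H for (@idfun R)}) (ip_norm : inner_product_norm ip)
    (u1 u2 : H) (eta1 eta2 : R) :
  let W1 := halfspace ip u1 eta1 in
  let W2 := halfspace ip u2 eta2 in
  let H1 := hyperplane ip u1 eta1 in
  (* (i) *)
  (lin_dep u1 u2 -> W1 `&` W2 !=set0 ->
    proj W2 \o proj W1 = proj (W1 `&` W2)) /\
  (* (ii) *)
  (lin_indep u1 u2 ->
    (* (a) *)
    (ip u1 u2 = 0 -> proj W2 \o proj W1 = proj (W1 `&` W2)) /\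
    (* (b) *)
    (ip u1 u2 < 0 ->
      let gamma := `|ip u1 u2| / (`|u1| * `|u2|) in
      (0 <= gamma < 1) /\
      forall (x : H) (k : nat),
        `|iter k (proj W2 \o proj W1) x - proj (W1 `&` W2) x|
          <= gamma ^+ k * `|x - proj (W1 `&` W2) x|) /\
    (* (c) *)
    (0 < ip u1 u2 ->
      (forall x : H, (W1 `&` W2) (proj W2 (proj W1 x))) /\
      (forall x : H, (W1 `|` W2) x ->
        proj W2 (proj W1 x) = proj (W1 `&` W2) x) /\
      (forall x : H, (~` W1 `&` ~` W2) x -> W2 (proj H1 x) ->
        proj W2 (proj W1 x) = proj H1 x /\
        proj H1 x = proj (W1 `&` W2) x) /\
      (forall x : H, (~` W1 `&` ~` W2) x -> ~ W2 (proj H1 x) ->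
        ((W1 `&` W2) `\ proj (W1 `&` W2) x) (proj W2 (proj W1 x))))).
Proof.
move=> W1 W2 H1; split.
  by move=> dep W0; apply/funext => x; exact: proj_comp_dep.
move=> uv; have u10 := lin_indep_neq0 uv.
have u20 := lin_indep_neq0 (lin_indepC uv).
split; first by move=> g0; apply/funext => x; exact: proj_comp_orthogonal.
split.
  move=> g0 gamma; split; first exact: (normal_cos_bounds ip_norm uv).
  by move=> x k; apply: iter_alternating_contraction => //; exact: ltW.
move=> g0; have g0' := ltW g0.
(* Outside [W1] the projections onto [W1] and its boundary coincide, so the
   last two claims speak of [proj W1 x]. *)
have PH1 x : ~ W1 x -> proj H1 x = proj W1 x.
  move=> /negP; rewrite -ltNge => /ltW xW.
  by rewrite (proj_hyperplane ip_norm)// (proj_halfspace_out ip_norm).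
split; first by move=> x; exact: proj_comp_acute_mem.
split; first by move=> x; exact: proj_comp_acute_union.
split=> x [xW1 xW2]; rewrite PH1// => pW2.
  by rewrite (proj_id ip_norm pW2) (proj_halfspaceI ip_norm).
split; first exact: proj_comp_acute_mem.
exact: proj_comp_acute_neq.
Qed.
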